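(* Let $f:\mathbb{R}\to\mathbb{R}$ be a twice differentiable function (in the sense defined in the context) such that $f(0)\le 0$ and the function $t\mapsto f''(t)+f''(-t)$ is nondecreasing for $t>0$. Then, for all independent symmetric real random variables $\xi$ and $\eta$, $$\mathbf{E} f(\xi)+\mathbf{E} f(\eta)\le \mathbf{E} f(\xi+\eta)$$ whenever the expectations exist.
   Context: A function $f$ on the real line is called twice differentiable if $f'(y)$ exists for all $y$, $f''(y)$ exists for almost all $y$ (with respect to Lebesgue measure), and $f'(b)-f'(a)=\int_a^b f''(y)\,dy$ for all $a<b$. Since $f''$ is only required to exist almost everywhere, the monotonicity of $f''(t)+f''(-t)$ is understood on the set of those $t>0$ for which $f''$ is defined at both $t$ and $-t$. A random variable $\xi$ is symmetric if $\xi$ and $-\xi$ have the same distribution. *)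

(* Defs.v *)
From mathcomp Require Export all_boot all_order all_algebra.
From mathcomp Require Export all_classical all_reals all_analysis.

Set Implicit Arguments.
Unset Strict Implicit.
Unset Printing Implicit Defensive.

Export Order.TTheory GRing.Theory Num.Theory.
Export numFieldNormedType.Exports.
Local Open Scope classical_set_scope.
Local Open Scope ring_scope.

(* Where [f'] has no derivative, [f''] takes the default value 0.
   The exceptional set is null, and Borel because [f'] turns out to be
   continuous, so neither the integrability of [f''] (which includes its
   measurability) nor its integral depends on that default. *)
Definition twice_differentiable (R : realType) (f : R -> R) : Prop :=
  let f' : R -> R := derive1 f in
  let f'' : R -> R := derive1 f' in
  [/\ forall y : R, derivable f y 1,
      {ae @lebesgue_measure R, forall y : R, derivable f' y 1} &
      forall a b : R, a < b ->
        (@lebesgue_measure R).-integrable `[a, b] (EFin \o f'') /\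
        f' b - f' a = \int[lebesgue_measure]_(y in `[a, b]) f'' y].

Definition nondecreasing_second_sum (R : realType) (f : R -> R) : Prop :=
  let f' : R -> R := derive1 f in
  let f'' : R -> R := derive1 f' in
  let D := [set t : R | [/\ 0 < t, derivable f' t 1 & derivable f' (- t) 1]] in
  forall s t : R, D s -> D t -> s <= t ->
    f'' s + f'' (- s) <= f'' t + f'' (- t).

(* Equality is only required on measurable sets: a measure has no meaningful
   value elsewhere. *)
Definition symmetric_RV (d : measure_display) (T : measurableType d)
    (R : realType) (P : probability T R) (X : {RV P >-> R}) : Prop :=
  forall A : set R, measurable A ->
    distribution P X A = pushforward P (\- X) A.

Definition independent_RV (d : measure_display) (T : measurableType d)
    (R : realType) (P : probability T R) (X Y : {RV P >-> R}) : Prop :=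
  forall A B : set R, measurable A -> measurable B ->
    P (X @^-1` A `&` Y @^-1` B) = (P (X @^-1` A) * P (Y @^-1` B))%E.

(* The expectation exists, possibly as an infinite value, when the positive and
   negative parts do not both have infinite integral. *)
Definition expectation_exists (d : measure_display) (T : measurableType d)
    (R : realType) (P : probability T R) (g : T -> R) : Prop :=
  measurable_fun setT g /\
  ((\int[P]_w (g^\+ w)%:E < +oo)%E \/ (\int[P]_w (g^\- w)%:E < +oo)%E).

(* Main.v *)
(* Put g t := f t + f (- t).  On the half-line t >= 0 the derivative
   g' t = f' t - f' (- t) vanishes at 0 and is the integral of an a.e.
   nondecreasing function, so g' t / t is nondecreasing.  Hence for 0 <= y <= x
   the y-derivative g' (x + y) - g' (x - y) - 2 g' y of
   g (x + y) + g (x - y) - 2 g x - 2 g y is nonnegative, and since g 0 <= 0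
   this expression is nonnegative.  That is the claimed inequality averaged over
   the four sign changes (+-x, +-y), which preserve the joint law of (xi, eta).
   To allow infinite expectations, positive and negative parts are kept on the
   sides where they are nonnegative until the integrals have been compared. *)
Require Import Defs.
From mathcomp Require Import ring lra measurable_realfun.

Local Open Scope classical_set_scope.
Local Open Scope ring_scope.

(** * Lebesgue integrals: almost-everywhere bounds and reflection *)

Lemma ae_le_Rintegral (d : measure_display) (T : measurableType d)
    (R : realType) (mu : {measure set T -> \bar R}) (D : set T) (f g : T -> R) :
  measurable D -> mu.-integrable D (EFin \o f) ->
  mu.-integrable D (EFin \o g) -> {ae mu, forall x, D x -> f x <= g x} ->
  \int[mu]_(x in D) f x <= \int[mu]_(x in D) g x.
Proof.
move=> mD intf intg [N [mN N0 fgN]].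
rewrite /Rintegral (negligible_integral mN mD intf N0).
rewrite (negligible_integral mN mD intg N0).
have mDN : measurable (D `\` N) by exact: measurableD.
apply: (le_Rintegral mDN).
- exact: integrableS intf.
- exact: integrableS intg.
- move=> x [Dx Nx]; apply: contrapT => fg.
  by apply: Nx; apply: fgN => /= /(_ Dx).
Qed.

Lemma lebesgue_aeN (R : realType) (Q : R -> Prop) :
  {ae @lebesgue_measure R, forall y : R, Q y} ->
  {ae @lebesgue_measure R, forall y : R, Q (- y)}.
Proof.
move=> [N [mN N0 QN]].
have mNr : measurable_fun setT (-%R : R -> R) by [].
have mNN : measurable (-%R @^-1` N : set R).
  by rewrite -[X in measurable X]setTI; exact: mNr.
exists (-%R @^-1` N); split => //.
  by rewrite -[RHS]N0 -(lebesgue_measureN mN).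
by move=> y /= /(QN (- y)).
Qed.

Lemma integrable_lebesgueN (R : realType) (D : set R) (f : R -> R) :
  measurable D -> (@lebesgue_measure R).-integrable D (EFin \o f) ->
  (@lebesgue_measure R).-integrable (-%R @^-1` D) (EFin \o (f \o -%R)) /\
  \int[@lebesgue_measure R]_(x in -%R @^-1` D) f (- x) =
  \int[@lebesgue_measure R]_(x in D) f x.
Proof.
move=> mD intf.
pose phi : measurableTypeR R -> measurableTypeR R := -%R.
have mphi : measurable_fun setT phi by exact: (_ : measurable_fun setT (-%R : R -> R)).
have mND : measurable (phi @^-1` D).
  by rewrite -[X in measurable X]setTI; exact: mphi.
(* Extension by 0 outside [D]: the change of variables along [phi] is applied to a function
   measurable on the whole line. *)
pose h : measurableTypeR R -> \bar R := (EFin \o f) \_ D.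
have mf : measurable_fun setT h.
  by apply/(measurable_restrictT _ _).1 => //; case/integrableP : intf.
have intN : (@lebesgue_measure R).-integrable (phi @^-1` D)
    (h \o phi).
  apply/integrableP; split.
    by apply: measurable_funTS; exact: measurableT_comp.
  have -> : (\int[@lebesgue_measure R]_(x in phi @^-1` D)
     `|(h \o phi) x| =
     \int[pushforward lebesgue_measure phi]_(y in D)
       (`|h y|))%E.
    rewrite ge0_integral_pushforward//.
    by apply: measurable_funTS; exact: measurableT_comp.
  have -> : (\int[pushforward lebesgue_measure phi]_(y in D)
       (`|h y|) =
     \int[@lebesgue_measure R]_(y in D) (`|h y|))%E.
    by apply: eq_measure_integral => //= A mA _; exact: lebesgue_measureN.
  case/integrableP : intf => _; apply: le_lt_trans.
  rewrite le_eqVlt; apply/orP; left; apply/eqP.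
  by apply: eq_integral => y yD; rewrite /h patchE yD.
have eN x : x \in phi @^-1` D ->
    (h \o phi) x = (f (- x))%:E.
  by rewrite inE /= => Dx; rewrite /h/= patchE mem_set.
split.
  by move: intN; apply: eq_integrable.
rewrite /Rintegral; congr fine.
rewrite -(eq_integral _ _ eN) -(integral_pushforward mphi mf intN mD).
transitivity (\int[@lebesgue_measure R]_(y in D) h y)%E.
  by apply: eq_measure_integral => //= A mA _; exact: lebesgue_measureN.
by apply: eq_integral => y yD; rewrite /h patchE yD.
Qed.

(** Otherwise a null set would contain an interval of positive length. *)
Lemma lebesgue_ae_itv (R : realType) (Q : R -> Prop) (a b : R) :
  {ae @lebesgue_measure R, forall y : R, Q y} -> a < b ->
  exists2 t, a < t < b & Q t.
Proof.
move=> [N [mN N0 QN]] ab; apply: contrapT => noQ.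
have abN : `]a, b[ `<=` N.
  move=> t /=; rewrite in_itv/= => tab; apply: QN => /= Qt.
  by apply: noQ; exists t.
have : (@lebesgue_measure R `]a, b[ <= lebesgue_measure N)%E.
  by apply: le_measure => //; rewrite inE//; exact: measurable_itv.
rewrite N0 lebesgue_measure_itv/= lte_fin ab -EFinB lee_fin.
by rewrite subr_le0 leNgt ab.
Qed.

Lemma Rintegral_itv_le_cst (R : realType) (G : R -> R) (a b c : R) :
  a < b -> (@lebesgue_measure R).-integrable `[a, b] (EFin \o G) ->
  {ae @lebesgue_measure R, forall t, a < t < b -> G t <= c} ->
  \int[lebesgue_measure]_(x in `[a, b]) G x <= c * (b - a).
Proof.
move=> ab intG Gc.
have mab : measurable (`]a, b[ : set R) by exact: measurable_itv.
have intG' : (@lebesgue_measure R).-integrable `]a, b[ (EFin \o G).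
  by apply: integrableS intG => //; apply: subset_itvScc; rewrite ?bnd_simp.
(* The endpoints are dropped, since the bound is only assumed strictly between them. *)
rewrite -Rintegral_itv_obnd_cbnd; last first.
  by apply: integrableS intG => //; apply: subset_itvScc; rewrite ?bnd_simp.
rewrite -Rintegral_itv_bndo_bndc//.
have -> : c * (b - a) = \int[@lebesgue_measure R]_(x in `]a, b[) c.
  by rewrite Rintegral_cst//=; rewrite lebesgue_measure_itv/= lte_fin ab.
apply: ae_le_Rintegral => //.
  apply/integrableP; split; first exact/measurable_EFinP/measurable_cst.
  rewrite /= integral_cst//=; rewrite lebesgue_measure_itv/= lte_fin ab -EFinB.
  by rewrite -EFinM ltry.
Qed.

Lemma Rintegral_itv_ge_cst (R : realType) (G : R -> R) (a b c : R) :
  a < b -> (@lebesgue_measure R).-integrable `[a, b] (EFin \o G) ->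
  {ae @lebesgue_measure R, forall t, a < t < b -> c <= G t} ->
  c * (b - a) <= \int[lebesgue_measure]_(x in `[a, b]) G x.
Proof.
move=> ab intG Gc; rewrite -lerN2 -mulNr.
have mab : measurable (`[a, b] : set R) by exact: measurable_itv.
have -> : - (\int[lebesgue_measure]_(x in `[a, b]) G x) =
    \int[lebesgue_measure]_(x in `[a, b]) (- 1 * G x).
  by rewrite RintegralZl// mulN1r.
apply: Rintegral_itv_le_cst => //.
  have := integrableN intG; apply: eq_integrable => //= x _.
  by rewrite /= mulN1r.
have ae_filter := ae_filter_ringOfSetsType (@lebesgue_measure R).
by apply: filterS Gc => t Gt /Gt; rewrite mulN1r lerN2.
Qed.

(** * Derivatives of the even part g t = f t + f (- t) *)

Lemma Rintegral_second_sum (R : realType) (f : R -> R) (a b : R) :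
  twice_differentiable f -> a < b ->
  let G := fun t => derive1 (derive1 f) t + derive1 (derive1 f) (- t) in
  (@lebesgue_measure R).-integrable `[a, b] (EFin \o G) /\
  \int[lebesgue_measure]_(t in `[a, b]) G t =
  (derive1 f b - derive1 f (- b)) - (derive1 f a - derive1 f (- a)).
Proof.
move=> [_ _ ftc] ab /=.
have [int1 e1] := ftc _ _ ab.
(* The term f'' (- t) on [a, b] is handled by the fundamental theorem on the reflected interval,
   carried back by t -> - t. *)
have [int2 e2] : (@lebesgue_measure R).-integrable `[- b, - a]
    (EFin \o derive1 (derive1 f)) /\ derive1 f (- a) - derive1 f (- b) =
    \int[lebesgue_measure]_(y in `[- b, - a]) derive1 (derive1 f) y.
  by apply: ftc; rewrite ltrN2.
have mab : measurable (`[a, b] : set R) by exact: measurable_itv.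
have [] := integrable_lebesgueN _ _ _ (measurable_itv _) int2.
rewrite opp_preimage_itvbndbnd/= !opprK => int3 e3.
split.
  have := @integrableD _ _ _ lebesgue_measure _ mab _ _ int1 int3; exact: eq_integrable.
have eD := @RintegralD _ _ _ lebesgue_measure _ _ _ mab int1 int3.
by rewrite [LHS]eD [X in _ + X = _]e3 -e1 -e2; ring.
Qed.

(** This is the monotonicity of g' t / t, cross-multiplied so that [s = 0] is covered. Since g' 0 =
    0, g' s / s is the mean of g'' over [0, s]; it is at most the mean over [s, b], because a single
    constant separates the values of g'' on the two sides of [s]. *)
Lemma odd_deriv_star_shaped (R : realType) (f : R -> R) (s b : R) :
  twice_differentiable f -> nondecreasing_second_sum f -> 0 <= s <= b ->
  b * (derive1 f s - derive1 f (- s)) <= s * (derive1 f b - derive1 f (- b)).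
Proof.
move=> hf hmono /andP[].
rewrite le_eqVlt => /predU1P[<- _|s0]; first by rewrite oppr0 !subrr mulr0 mul0r.
rewrite le_eqVlt => /predU1P[->//|sb].
have [int1 e1] := Rintegral_second_sum _ _ _ _ hf s0.
have [int2 e2] := Rintegral_second_sum _ _ _ _ hf sb.
set G := fun t => derive1 (derive1 f) t + derive1 (derive1 f) (- t)
  in int1 e1 int2 e2.
have ae_filter := ae_filter_ringOfSetsType (@lebesgue_measure R).
have [S aeS SG] : exists2 S : set R,
    {ae @lebesgue_measure R, forall t, 0 < t -> S t} &
    forall t u, S t -> S u -> t <= u -> G t <= G u.
  exists [set t : R | [/\ 0 < t, derivable (derive1 f) t 1 &
    derivable (derive1 f) (- t) 1]]; last exact: hmono.
  case: hf => _ aed _.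
  apply: filterS2 aed (lebesgue_aeN _ _ aed) => t d1 d2 t0.
  exact (And3 t0 d1 d2).
have [t1 /andP[t10 t1s] /(_ t10) St1] := lebesgue_ae_itv _ _ _ _ aeS s0.
have [t2 /andP[t2s t2b] /(_ (lt_trans s0 t2s)) St2] :=
  lebesgue_ae_itv _ _ _ _ aeS sb.
(* The separating constant is [sup V], not [G s], since f'' may fail to exist at [s] or [- s]. The
   points [t1] and [t2] make this supremum meaningful: one shows that [V] is nonempty, the other
   that it is bounded above. *)
pose V := [set G t | t in [set t | S t /\ t < s]].
have VG t : S t -> s < t -> ubound V (G t).
  move=> St st _ [u [Su us] <-]; apply: SG => //.
  by rewrite ltW// (lt_trans us).
have le1 : \int[lebesgue_measure]_(t in `[0, s]) G t <= sup V * (s - 0).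
  apply: Rintegral_itv_le_cst => //.
  apply: filterS aeS => t St /andP[t0 ts]; apply: ub_le_sup.
    by exists (G t2); exact: VG.
  by exists t => //; split => //; exact: St.
have le2 : sup V * (b - s) <= \int[lebesgue_measure]_(t in `[s, b]) G t.
  apply: Rintegral_itv_ge_cst => //.
  apply: filterS aeS => t St /andP[st tb]; apply: ge_sup.
    by exists (G t1), t1.
  by apply: VG => //; apply: St; exact: lt_trans st.
move: le1 le2; rewrite e1 e2 oppr0 addr0 subrr subr0.
set p := derive1 f s - _; set q := derive1 f b - _.
move: (sup V) => c pc cq.
(* With p <= c s and c (b - s) <= q - p, the chain is (b - s) p <= (b - s) c s <= s (q - p), that is
   b p <= s q. *)
have : s * p <= s * (c * s) by rewrite ler_pM2l.
have : s * (c * (b - s)) <= s * (q - p) by rewrite ler_pM2l.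
have : (b - s) * p <= (b - s) * (c * s) by rewrite ler_pM2l ?subr_gt0.
nra.
Qed.

Lemma even_part_superquadratic (R : realType) (f : R -> R) (x y : R) :
  twice_differentiable f -> f 0 <= 0 -> nondecreasing_second_sum f ->
  (f x + f (- x)) *+ 2 + (f y + f (- y)) *+ 2 <=
  f (x + y) + f (- (x + y)) + (f (x - y) + f (- (x - y))).
Proof.
move=> hf hf0 hmono.
(* The inequality is invariant under x -> - x, under y -> - y and under exchanging x and y, which
   reduces it to 0 <= y <= x. *)
wlog x0 : x / 0 <= x.
  move=> H; have [|x0] := leP 0 x; first exact: H.
  have := H (- x); rewrite oppr_ge0 (ltW x0) => /(_ isT).
  have -> : - x + y = - (x - y) by ring.
  have -> : - x - y = - (x + y) by ring.
  by rewrite !opprK; lra.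
wlog y0 : y / 0 <= y.
  move=> H; have [|y0] := leP 0 y; first exact: H.
  have := H (- y); rewrite oppr_ge0 (ltW y0) => /(_ isT).
  by rewrite !opprK; lra.
wlog yx : x y x0 y0 / y <= x.
  move=> H; have [|xy] := leP y x; first exact: H.
  have := H y x y0 x0 (ltW xy).
  have -> : y - x = - (x - y) by ring.
  by rewrite opprK [y + x]addrC; lra.
have df (u : R) : is_derive u (1 : R) f (derive1 f u).
  by case: hf => /(_ u) du _ _; split => //; rewrite derive1E.
have dcomp (a b z : R) : is_derive z (1 : R) (fun z => f (a + b * z))
    (derive1 f (a + b * z) * b).
  apply: (@is_derive1_comp _ f (fun z => a + b * z)).
  have -> : (fun z => a + b * z) = cst a + b \*: (id : R -> R).
    by apply/funext.
  by apply: is_derive_eq; rewrite /= add0r /GRing.scale/= mulr1.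
(* Every term has the shape [f (a + b * z)], so that [dcomp] supplies all the derivatives when
   [is_derive] is inferred; [kE] gives the readable form. *)
pose k : R -> R := (fun z => f (x + 1 * z)) + (fun z => f (- x + (- 1) * z)) +
   (fun z => f (x + (- 1) * z)) + (fun z => f (- x + 1 * z))
   - (fun z => f (0 + 1 * z)) - (fun z => f (0 + 1 * z))
   - (fun z => f (0 + (- 1) * z)) - (fun z => f (0 + (- 1) * z)).
have kE z : k z = f (x + z) + f (- (x + z)) + (f (x - z) + f (- (x - z)))
    - (f z + f (- z)) *+ 2.
  rewrite /k !fctE !mul1r !mulN1r !add0r !opprD !opprK; ring.
have dk z : is_derive z (1 : R) k
   ((derive1 f (x + z) - derive1 f (- (x + z)))
    - (derive1 f (x - z) - derive1 f (- (x - z)))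
    - (derive1 f z - derive1 f (- z)) *+ 2).
  apply: is_derive_eq.
  rewrite !mul1r !mulN1r !add0r !opprD !opprK; ring.
(* Here [f 0 <= 0] enters, as k 0 = 2 g x - 4 f 0. *)
have k0 : (f x + f (- x)) *+ 2 <= k 0.
  by rewrite kE oppr0 !addr0; lra.
suff : k 0 <= k y by rewrite (kE y); lra.
apply: (@ger0_derive1_ndecr _ k 0 x) => //.
- move=> z; rewrite in_itv/= => /andP[z0 zx].
  have [_ dkz] := dk z; rewrite derive1E dkz.
  (* Both uses compare with the same endpoint x + z. They give (x + z) r <= (x - z) p and (x + z) q
     <= z p; the first plus twice the second is (x + z) (r + 2 q) <= (x + z) p. *)
  have /(odd_deriv_star_shaped _ _ _ _ hf hmono) : 0 <= x - z <= x + z by lra.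
  have /(odd_deriv_star_shaped _ _ _ _ hf hmono) : 0 <= z <= x + z by lra.
  set p := derive1 f (x + z) - _; set q := derive1 f z - _.
  set r := derive1 f (x - z) - _ => qp rp.
  rewrite -(pmulr_rge0 _ (_ : 0 < x + z)); last lra.
  nra.
- by apply: derivable_within_continuous => z _; case: (dk z).
Qed.

(** * Joint law of the pair and its invariance under sign changes *)

Lemma ge0_integral_product_law (d : measure_display) (T : measurableType d)
    (R : realType) (P : probability T R) (xi eta : {RV P >-> R}) (X Y : T -> R)
    (k : R * R -> \bar R) :
  measurable_fun setT X -> measurable_fun setT Y ->
  (forall A B : set R, measurable A -> measurable B ->
    P (X @^-1` A `&` Y @^-1` B) = (P (xi @^-1` A) * P (eta @^-1` B))%E) ->
  measurable_fun setT k -> (forall z, (0 <= k z)%E) ->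
  (\int[P]_w k (X w, Y w) =
   \int[distribution P xi \x distribution P eta]_z k z)%E.
Proof.
move=> mX mY XY mk k0.
have mXY : measurable_fun setT (fun w => (X w, Y w)).
  exact: measurable_fun_pair.
transitivity (\int[pushforward P (fun w => (X w, Y w))]_z k z)%E.
  by rewrite ge0_integral_pushforward.
(* The law of [(X, Y)] agrees with the product measure on rectangles, hence everywhere by uniqueness
   of the product measure. *)
apply: eq_measure_integral => A mA _; apply/esym.
exact: product_measure_unique.
Qed.

(** By symmetry, reflecting the sides of a rectangle leaves its probability unchanged. Both the
    signed and the original pair therefore have the product of the laws of [xi] and [eta] as joint
    law. *)
Lemma ge0_integral_signs (d : measure_display) (T : measurableType d)
    (R : realType) (P : probability T R) (xi eta : {RV P >-> R})
    (k : R * R -> \bar R) (s t : bool) :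
  independent_RV xi eta -> symmetric_RV xi -> symmetric_RV eta ->
  measurable_fun setT k -> (forall z, (0 <= k z)%E) ->
  (\int[P]_w k ((-1) ^+ s * xi w, (-1) ^+ t * eta w)%R =
   \int[P]_w k (xi w, eta w))%E.
Proof.
move=> hind hxi heta mk k0.
have mxi : measurable_fun setT xi by [].
have meta : measurable_fun setT eta by [].
pose flip (b : bool) (A : set R) := (fun x => (-1) ^+ b * x) @^-1` A.
have mflip b (A : set R) : measurable A -> measurable (flip b A).
  move=> mA; rewrite -[X in measurable X]setTI.
  have mM : measurable_fun setT (fun x : R => (-1) ^+ b * x).
    exact: measurable_funM.
  exact: mM.
have sym (X : {RV P >-> R}) b (A : set R) : symmetric_RV X -> measurable A ->
    P (X @^-1` flip b A) = P (X @^-1` A).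
  move=> hX mA; case: b; last first.
    by congr (P _); apply/funext => w; rewrite /flip/preimage/= expr0 mul1r.
  rewrite -[RHS]/(distribution P X A) (hX A mA).
  by congr (P _); apply/funext => w; rewrite /flip/preimage/= expr1 mulN1r.
rewrite !(ge0_integral_product_law _ _ _ _ xi eta)//.
- exact: measurable_funM.
- exact: measurable_funM.
- move=> A B mA mB.
  rewrite -(sym xi s)// -(sym eta t)//.
  exact: (hind _ _ (mflip s A mA) (mflip t B mB)).
Qed.

(** * Positive and negative parts, and averaging over the four signs *)

Lemma expectation_funrposneg (d : measure_display) (T : measurableType d)
    (R : realType) (P : probability T R) (h : T -> R) :
  ('E_P[h] = \int[P]_w (h^\+ w)%:E - \int[P]_w (h^\- w)%:E)%E.
Proof.
rewrite unlock integralE.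
by rewrite -[fun x => (h x)%:E]/(EFin \o h) funerpos funerneg.
Qed.

(** In [\bar R] a sum with a term [-oo] is [-oo], so an infinite a' or b' makes the left side [-oo].
    The disjunction excludes c = c' = +oo, where c - c' would be [-oo] as well. *)
Lemma lee_sub_of_add_parts (R : realType) (a a' b b' c c' : \bar R) :
  (0 <= a -> 0 <= a' -> 0 <= b -> 0 <= b' -> 0 <= c -> 0 <= c' ->
  c < +oo \/ c' < +oo ->
  a + b + c' <= a' + b' + c -> (a - a') + (b - b') <= c - c')%E.
Proof.
move=> a0 a'0 b0 b'0 c0 c'0 cc'.
case: a' a'0 => [a'| |]// _; last by rewrite [(- +oo)%E]/= addeNy addNye leNye.
case: b' b'0 => [b'| |]// _; last by rewrite [(- +oo)%E]/= !addeNy leNye.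
case: c' c'0 cc' => [c'| |]// _ cc'; last first.
  rewrite addey; last by rewrite gt_eqF// (lt_le_trans _ (adde_ge0 a0 b0)).
  by case: cc'; case: c c0 => [c| |].
case: c c0 {cc'} => [c| |]// _; last by move=> _; rewrite addye// leey.
case: a a0 => [a| |]// _; last by case: b b0 => [b| |].
case: b b0 => [b| |]// _.
rewrite -?EFinN -?EFinD !lee_fin; lra.
Qed.

(** The four summands have equal integrals by sign invariance. Nonnegativity of [k] keeps the
    integral additive even when it is infinite. *)
Lemma integral_sign_symmetrization (d : measure_display) (T : measurableType d)
    (R : realType) (P : probability T R) (xi eta : {RV P >-> R})
    (k : R -> R -> R) :
  independent_RV xi eta -> symmetric_RV xi -> symmetric_RV eta ->
  measurable_fun setT (fun z : R * R => k z.1 z.2) ->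
  (forall x y, 0 <= k x y) ->
  (\int[P]_w (k (xi w) (eta w) + k (xi w) (- eta w) +
              (k (- xi w) (eta w) + k (- xi w) (- eta w)))%:E =
   4%:R%:E * \int[P]_w (k (xi w) (eta w))%:E)%E.
Proof.
move=> hind hxi heta mk k0.
have mxi : measurable_fun setT xi by [].
have meta : measurable_fun setT eta by [].
pose K (z : R * R) := (k z.1 z.2)%:E.
have mK : measurable_fun setT K by exact/measurable_EFinP.
have K0 z : (0 <= K z)%E by rewrite lee_fin.
have flip s t := ge0_integral_signs _ _ _ P xi eta K s t hind hxi heta mK K0.
have mKst s t : measurable_fun setT
    (fun w => K ((-1) ^+ s * xi w, (-1) ^+ t * eta w)).
  apply: measurableT_comp => //.
  by apply: measurable_fun_pair; exact: measurable_funM.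
(* The signs are written as powers of -1 so that [flip] rewrites all four integrals at once. *)
transitivity (\int[P]_w (
   K ((-1) ^+ false * xi w, (-1) ^+ false * eta w)%R +
   K ((-1) ^+ false * xi w, (-1) ^+ true * eta w)%R +
  (K ((-1) ^+ true * xi w, (-1) ^+ false * eta w)%R +
   K ((-1) ^+ true * xi w, (-1) ^+ true * eta w)%R)))%E.
  by apply: eq_integral => w _; rewrite /K/= !expr0 !expr1 !mul1r !mulN1r.
rewrite ge0_integralD//; last 4 first.
- by move=> w _; rewrite adde_ge0.
- exact: emeasurable_funD.
- by move=> w _; rewrite adde_ge0.
- exact: emeasurable_funD.
rewrite !ge0_integralD// !flip /K/=.
have : (0 <= \int[P]_w (k (xi w) (eta w))%:E)%E.
  by apply: integral_ge0 => w _; rewrite lee_fin.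
case: (\int[P]_w _)%E => [r| |] //= _; last by rewrite mulry gtr0_sg// mul1e.
by rewrite -!EFinD -EFinM; congr EFin; ring.
Qed.

(** [k f x y <= k (\- f) x y] amounts to f x + f y <= f (x + y), with negative parts moved across so
    that both sides are nonnegative. Summed over the four signs, it becomes the inequality for the
    even part. *)
Lemma sign_average_funrposneg (R : realType) (f : R -> R) (x y : R)
    (k := fun (f : R -> R) x y => f^\+ x + f^\+ y + f^\- (x + y)) :
  twice_differentiable f -> f 0 <= 0 -> nondecreasing_second_sum f ->
  k f x y + k f x (- y) + (k f (- x) y + k f (- x) (- y)) <=
  k (\- f) x y + k (\- f) x (- y) + (k (\- f) (- x) y + k (\- f) (- x) (- y)).
Proof.
move=> hf hf0 hmono.
have := even_part_superquadratic R f x y hf hf0 hmono.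
have fE z : f z = f^\+ z - f^\- z by rewrite -{1}(funrposBneg f).
rewrite /k funrposN funrnegN opprD opprB.
rewrite [- x + y]addrC !fE; lra.
Qed.

Theorem theorem1 (R : realType) (f : R -> R)
    (hf : twice_differentiable f) (hf0 : f 0 <= 0)
    (hmono : nondecreasing_second_sum f)
    (d : measure_display) (T : measurableType d) (P : probability T R)
    (xi eta : {RV P >-> R})
    (hind : independent_RV xi eta)
    (hxi : symmetric_RV xi) (heta : symmetric_RV eta)
    (hExi : expectation_exists P (f \o xi))
    (hEeta : expectation_exists P (f \o eta))
    (hEsum : expectation_exists P (f \o (xi \+ eta))) :
  ('E_P[f \o xi] + 'E_P[f \o eta] <= 'E_P[f \o (xi \+ eta)%R])%E.
Proof.
have mf : measurable_fun setT f.
  apply: continuous_measurable_fun => x; case: hf => /(_ x) dfx _ _.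
  by apply: differentiable_continuous; exact/derivable1_diffP.
have mxi : measurable_fun setT xi by [].
have meta : measurable_fun setT eta by [].
pose k (f : R -> R) x y := f^\+ x + f^\+ y + f^\- (x + y).
have k_ge0 g x y : 0 <= k g x y.
  by rewrite !addr_ge0// ?funrpos_ge0// funrneg_ge0.
have mk g : measurable_fun setT g ->
    measurable_fun setT (fun z : R * R => k g z.1 z.2).
  move=> mg; apply: measurable_funD; first apply: measurable_funD.
  - by apply: measurableT_comp; [exact: measurable_funrpos|].
  - by apply: measurableT_comp; [exact: measurable_funrpos|].
  - apply: (measurableT_comp (measurable_funrneg mg)).
    exact: measurable_funD.
have intk g : measurable_fun setT g ->
    (\int[P]_w (k g (xi w) (eta w))%:E =
     \int[P]_w (g^\+ (xi w))%:E + \int[P]_w (g^\+ (eta w))%:E +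
     \int[P]_w (g^\- (xi w + eta w))%:E)%E.
  move=> mg.
  have mpos (X : T -> R) : measurable_fun setT X ->
      measurable_fun setT (fun w => (g^\+ (X w))%:E).
    move=> mX; apply/measurable_EFinP.
    exact: (measurableT_comp (measurable_funrpos mg)).
  have mneg : measurable_fun setT (fun w => (g^\- (xi w + eta w))%:E).
    apply/measurable_EFinP; apply: (measurableT_comp (measurable_funrneg mg)).
    exact: measurable_funD.
  rewrite -ge0_integralD//; last 4 first.
  - by move=> w _; rewrite lee_fin.
  - exact: mpos.
  - by move=> w _; rewrite lee_fin.
  - exact: mpos.
  rewrite -ge0_integralD//.
  - by move=> w _; rewrite adde_ge0// lee_fin.
  - by apply: emeasurable_funD; exact: mpos.
  - by move=> w _; rewrite lee_fin.
have mNf : measurable_fun setT (\- f) by exact: measurable_funN.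
have mavg g : measurable_fun setT g -> measurable_fun setT (fun w =>
    (k g (xi w) (eta w) + k g (xi w) (- eta w) +
    (k g (- xi w) (eta w) + k g (- xi w) (- eta w)))%:E).
  move=> mg; apply/measurable_EFinP.
  have mkc (X Y : T -> R) : measurable_fun setT X -> measurable_fun setT Y ->
      measurable_fun setT (fun w => k g (X w) (Y w)).
    move=> mX mY.
    exact: (measurableT_comp (mk g mg) (measurable_fun_pair mX mY)).
  have mNxi : measurable_fun setT (fun w => - xi w) by exact: measurable_funN.
  have mNeta : measurable_fun setT (fun w => - eta w) by exact: measurable_funN.
  by apply: measurable_funD; apply: measurable_funD; exact: mkc.
(* Both integrands are nonnegative, so the pointwise inequality integrates without any integrability
   assumption. *)
have le_avg : (4%:R%:E * \int[P]_w (k f (xi w) (eta w))%:E <=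
    4%:R%:E * \int[P]_w (k (\- f) (xi w) (eta w))%:E)%E.
  rewrite -!integral_sign_symmetrization//; [|exact: mk|exact: mk].
  apply: ge0_le_integral => //.
  - by move=> w _; rewrite lee_fin !addr_ge0.
  - exact: mavg.
  - exact: mavg.
  - move=> w _; rewrite lee_fin; exact: sign_average_funrposneg.
move: le_avg; rewrite lee_pmul2l//.
rewrite !intk// funrposN funrnegN => le_parts.
rewrite !expectation_funrposneg.
(* Existence of the expectation of f (xi + eta) rules out the form +oo - +oo on the right-hand
   side. *)
apply: lee_sub_of_add_parts le_parts; last exact: (proj2 hEsum).
all: by apply: integral_ge0 => w _; rewrite lee_fin.
Qed.
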